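(* For every integer $n\ge 2$, one has $\operatorname{MaxCol}(n,n-1)\ge 2^{n-1}-1$.
   Context: $\operatorname{MaxCol}(n,d)$ denotes the maximum number of collisions that may occur between $n$ identical hard balls moving freely and colliding elastically in $\mathbb{R}^d$ (open space), where simultaneous collisions are prohibited. (It is known to be finite; $\operatorname{MaxCol}(n,d)\ge N$ means that there is a trajectory with at least $N$ collisions.) Precisely: the balls have radius $\frac12$ and centers $q_1,\dots,q_n\in\mathbb{R}^d$; a configuration is a point $q=(q_1,\dots,q_n)\in\mathbb{R}^{dn}$, and the configuration space is $\mathcal B_{d,n}=\{q\in\mathbb{R}^{dn}: |q_i-q_j|\ge 1 \text{ for all } i\ne j\}$. For $i<j$ let $C_{ij}=\{q\in\mathbb{R}^{dn}:|q_i-q_j|<1\}$; the walls are the boundaries $\partial C_{ij}=\{|q_i-q_j|=1\}$. At a point $q\in\partial C_{ij}$ the unit outer normal to $C_{ij}$ is the vector $\nu\in\mathbb{R}^{dn}$ whose $i$th $d$-dimensional component is $\frac1{\sqrt2}(q_i-q_j)$, whose $j$th one is $\frac1{\sqrt2}(q_j-q_i)$, and whose other components are $0$. A trajectory is a continuous piecewise linear curve $\gamma\colon I\to\mathcal B_{d,n}$ on an interval $I\subset\mathbb{R}$ which never lies on two distinct walls at the same moment (no simultaneous collisions), is linear near every moment at which it lies on no wall, and at every moment $t$ at which it lies on a wall with normal $\nu$ at $\gamma(t)$ satisfies the elastic (billiard) reflection rule $\gamma'(t_+)=\gamma'(t_-)-2\langle\gamma'(t_-),\nu\rangle\nu$.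 A collision is a moment $t$ at which $\gamma(t)$ lies on a wall and $\langle\gamma'(t_-),\nu\rangle\ne0$; no collisions occur at endpoints of $I$. *)

(* Defs.v *)
From mathcomp Require Import all_boot all_order all_algebra.
From mathcomp Require Import all_classical all_reals all_analysis.

Set Implicit Arguments.
Unset Strict Implicit.
Unset Printing Implicit Defensive.

Import Order.TTheory GRing.Theory Num.Theory.
Import numFieldNormedType.Exports.

Local Open Scope classical_set_scope.
Local Open Scope ring_scope.

(* A configuration of n balls of radius 1/2 in R^d is an n x d matrix whose
   i-th row is the center of the i-th ball; 'M[R]_(n, d) stands for R^(dn). *)

(* The library's norm `|A| on matrices is the sup norm, so the Euclidean
   structure is given separately; both induce the same topology. *)
Definition edot (R : realType) (m n : nat) (A B : 'M[R]_(m, n)) : R :=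
  \sum_(i < m) \sum_(j < n) A i j * B i j.

Definition enorm (R : realType) (m n : nat) (A : 'M[R]_(m, n)) : R :=
  Num.sqrt (edot A A).

Definition config_space (R : realType) (n d : nat) : set 'M[R]_(n, d) :=
  [set q | forall i j : 'I_n, i != j -> 1 <= enorm (row i q - row j q)].

Definition wall (R : realType) (n d : nat) (i j : 'I_n) : set 'M[R]_(n, d) :=
  [set q | enorm (row i q - row j q) = 1].

Definition wall_normal (R : realType) (n d : nat) (i j : 'I_n)
    (q : 'M[R]_(n, d)) : 'M[R]_(n, d) :=
  \matrix_(k < n) (if k == i then (Num.sqrt 2)^-1 *: (row i q - row j q)
                   else if k == j then (Num.sqrt 2)^-1 *: (row j q - row i q)
                   else 0).

Section Curves.
Context (R : realType) (n d : nat).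
Implicit Types (g : R -> 'M[R]_(n, d)) (I : interval R) (t : R).

(* One-sided derivatives. They are only used at interior points of the domain
   of a piecewise linear curve, where the limits exist. *)
Definition left_velocity g t : 'M[R]_(n, d) :=
  lim (h^-1 *: (g (t + h) - g t) @[h --> 0^'-]).

Definition right_velocity g t : 'M[R]_(n, d) :=
  lim (h^-1 *: (g (t + h) - g t) @[h --> 0^'+]).

Definition linear_on (J : set R) g : Prop :=
  exists a v : 'M[R]_(n, d), forall t, J t -> g t = a + t *: v.

Definition piecewise_linear I g : Prop :=
  exists breaks : seq R, forall a b : R, a \in I -> b \in I ->
    (forall c, c \in breaks -> c \notin `]a, b[) ->
    linear_on [set` `]a, b[] g.

(* A curve is a total function of which only the restriction to I matters. *)
Record trajectory I g : Prop := Trajectory {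
  trajectory_continuous : {within [set` I], continuous g};
  trajectory_piecewise_linear : piecewise_linear I g;
  trajectory_config : forall t, t \in I -> config_space (g t);
  trajectory_not_simultaneous : forall t, t \in I ->
    forall i j k l : 'I_n, (i < j)%N -> (k < l)%N ->
    wall i j (g t) -> wall k l (g t) -> i = k /\ j = l;
  trajectory_free : forall t, t \in I ->
    (forall i j : 'I_n, (i < j)%N -> ~ wall i j (g t)) ->
    exists2 U : set R, nbhs t U & linear_on ([set` I] `&` U) g;
  (* No wall is met at an endpoint of I, where the rule would not make sense. *)
  trajectory_reflection : forall t, t \in I ->
    forall i j : 'I_n, (i < j)%N -> wall i j (g t) ->
    [set` I]° t /\
    (let nu := wall_normal i j (g t) in
     right_velocity g t =
       left_velocity g t - (2 * edot (left_velocity g t) nu) *: nu)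
}.

Definition collision I g t : Prop :=
  [set` I]° t /\
  exists i j : 'I_n, [/\ (i < j)%N, wall i j (g t) &
    edot (left_velocity g t) (wall_normal i j (g t)) != 0].

End Curves.

(* MaxCol(n, d) >= N: some trajectory of n balls in R^d has at least N
   collision moments. *)
Definition MaxCol_ge (R : realType) (n d N : nat) : Prop :=
  exists (I : interval R) (g : R -> 'M[R]_(n, d)), trajectory I g /\
    exists ts : seq R,
      [/\ uniq ts, size ts = N & forall t, t \in ts -> collision I g t].

(* Main.v *)
Require Import Defs.
From mathcomp Require Import all_boot all_order all_algebra.
From mathcomp Require Import all_classical all_reals all_analysis.
From mathcomp Require Import ring lra.

Set Implicit Arguments.
Unset Strict Implicit.
Unset Printing Implicit Defensive.

Import Order.TTheory GRing.Theory Num.Theory.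
Import numFieldNormedType.Exports.

Local Open Scope classical_set_scope.
Local Open Scope ring_scope.

(** Write [n = m + 1]. One ball, the hub, is surrounded by [m] satellites which it
    almost touches, in directions forming a nearly orthonormal basis of the space
    of dimension [m]. Seen at a small scale, the [m] walls between the hub and
    the satellites are hyperplanes, and the state of the system is given by the widths of the [m] contacts and the velocities at which
    they open.

    For hyperplanes, the number of collisions obeys [N -> 2 N + 1] when a
    satellite is added. Suppose that a start with widths [f] and velocities [p]
    leads to [N] hits. Place the new satellite so that a head-on collision of it
    with the hub, all other balls being at rest, gives the old contacts just the
    velocities [p]; this prescribes the inner products of the new direction with
    the old ones, and by means of the additional dimension they can be
    prescribed at will as long as they are small. After this collision the [N]
    hits occur, and the new contact does not interfere if it opens fast. But
    a trajectory that meets a wall perpendicularly is symmetric under time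
    reversal, so before the collision there were [N] hits as well. Starting from
    [0] for [m = 0], one obtains [2 ^ m - 1] ([ruler_flat_run]); the order of
    the hits is the ruler sequence 1 2 1 3 1 2 1 and so on.

    All hits are transversal and all other conditions are strict inequalities.
    Hence the trajectory survives when the hyperplanes are bent slightly into the
    true walls, which is their shape at a small scale [e > 0]
    ([flat_run_perturb]): the times of the hits are roots of quadratics that
    depend continuously on [e] up to [e = 0]. A finite itinerary of straight
    segments and elastic reflections is finally turned into a piecewise linear
    curve ([run_MaxCol]). *)

(** * Billiards between hyperplanes *)

Section LinearModel.
Context (R : realType).

(** The motion of a hub ball and [m] satellites, blown up at a configuration in
    which the hub touches every satellite and every wall has become a
    hyperplane. The state of contact [j] is its width [f j] together with the
    velocity [p j] at which it opens, and [G] is the Gram matrix of the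
    directions [u_j] from the satellites to the hub. When contact [i] closes,
    the hub loses [p i *: u_i] and satellite [i] gains it. Every contact sees
    the change of the hub, and contact [i] sees that of its satellite too:
    hence the factor [(i == j).+1]. The step leaves open contacts after time
    [t], in which [i] closes, and a further time [s]. *)
Record flat_step m (G : 'M[R]_m) (i : 'I_m) (f p f' p' : 'I_m -> R)
    (t s : R) : Prop := FlatStep {
  flat_t : 0 < t;
  flat_s : 0 < s;
  flat_before : forall j, 0 < f j;
  flat_after : forall j, 0 < f' j;
  flat_hit : f i + t * p i = 0;
  flat_miss : forall j, j != i -> 0 < f j + t * p j;
  flat_rate : forall j, p' j = p j - p i * G i j *+ (i == j).+1;
  flat_gap : forall j, f' j = f j + t * p j + s * p' j
}.

(** Consecutive steps start and end with all contacts open, so that runs can be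
    concatenated, reversed, and later perturbed one step at a time. *)
Inductive flat_run m (G : 'M[R]_m) :
    nat -> ('I_m -> R) -> ('I_m -> R) -> ('I_m -> R) -> ('I_m -> R) -> Prop :=
| flat_run_free f p : (forall j, 0 < f j) -> flat_run G 0 f p f p
| flat_run_hit N i f p f1 p1 f2 p2 t s : flat_step G i f p f1 p1 t s ->
    flat_run G N f1 p1 f2 p2 -> flat_run G N.+1 f p f2 p2.

Lemma flat_run_before m (G : 'M[R]_m) N f p f' p' :
  flat_run G N f p f' p' -> forall j, 0 < f j.
Proof. by case=> // {}N i {}f {}p f1 p1 f2 p2 t s []. Qed.

Lemma flat_run_cat m (G : 'M[R]_m) N1 N2 f p f1 p1 f2 p2 :
  flat_run G N1 f p f1 p1 -> flat_run G N2 f1 p1 f2 p2 -> flat_run G (N1 + N2) f p f2 p2.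
Proof.
by elim=> // N i f0 p0 f3 p3 f4 p4 t s st _ IH /IH; apply: flat_run_hit st.
Qed.

Lemma flat_step_rev m (G : 'M[R]_m) i f p f' p' t s : G i i = 1 ->
  flat_step G i f p f' p' t s -> flat_step G i f' (\- p') f (\- p) s t.
Proof.
move=> Gii [t0 s0 before after hit miss rate gap].
have p'i : p' i = - p i by rewrite rate Gii eqxx mulr1 mulr2n; ring.
split=> // [|j ji|j|j] /=.
- by rewrite gap hit p'i; ring.
- by rewrite gap mulrN addrK miss.
- by rewrite p'i rate mulNr mulNrn opprK; ring.
- by rewrite gap; ring.
Qed.

Lemma flat_run_rev m (G : 'M[R]_m) N f p f' p' : (forall i, G i i = 1) ->
  flat_run G N f p f' p' -> flat_run G N f' (\- p') f (\- p).
Proof.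
move=> Gii; elim=> [? ? ?|{}N i {}f {}p f1 p1 f2 p2 t s st _ IH].
  exact: flat_run_free.
rewrite -addn1; apply: flat_run_cat IH _.
apply: flat_run_hit (flat_step_rev (Gii i) st) _.
by apply: flat_run_free; case: st.
Qed.

(** A further contact, added at index [ord0], is a mere spectator when it opens
    fast enough. The old contacts change its opening velocity by at most [h]
    times a constant [K] read off the run, where [h] bounds the Gram products of
    the new direction with the old ones; the new contact therefore keeps opening
    and never acts on the others. *)
Lemma flat_run_lift m (G : 'M[R]_m) N f p f' p' : flat_run G N f p f' p' ->
  exists2 K, 0 <= K & forall (G' : 'M[R]_m.+1) h F P, 0 <= h ->
    (forall i j, G' (lift ord0 i) (lift ord0 j) = G i j) ->
    (forall i, `|G' (lift ord0 i) ord0| <= h) ->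
    0 < F ord0 -> K * h < P ord0 ->
    (forall j, F (lift ord0 j) = f j) -> (forall j, P (lift ord0 j) = p j) ->
  exists F' P', flat_run G' N F P F' P'.
Proof.
elim=> [{}f {}p f_gt0|{}N i {}f {}p f1 p1 f2 p2 t s st _ [K K0 IH]].
  exists 0 => // G' h F P _ _ _ F0 _ Ff _; exists F, P; apply: flat_run_free => k.
  by case: (unliftP ord0 k) => [j|] -> //; rewrite Ff.
exists (K + `|p i|); first by rewrite addr_ge0.
move=> G' h F P h0 GG Gh F0 PK Ff Pp.
pose i' := lift ord0 i.
pose P1 k := P k - P i' * G' i' k *+ (i' == k).+1.
pose F1 k := F k + t * P k + s * P1 k.
have P1p j : P1 (lift ord0 j) = p1 j.
  by rewrite /P1 !Pp GG (inj_eq (lift_inj (h:=ord0))) (flat_rate st).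
have F1f j : F1 (lift ord0 j) = f1 j.
  by rewrite /F1 Ff Pp P1p (flat_gap st).
have [t0 s0] := (flat_t st, flat_s st).
have P00 : 0 < P ord0 by apply: le_lt_trans PK; rewrite mulr_ge0 ?addr_ge0.
have P10 : K * h < P1 ord0.
  rewrite /P1 Pp /= mulr1n.
  have : p i * G' i' ord0 <= `|p i| * h.
    by apply: (le_trans (ler_norm _)); rewrite normrM ler_wpM2l // Gh.
  by move: PK; rewrite mulrDl; lra.
have F10 : 0 < F1 ord0.
  rewrite /F1 -addrA ltr_wpDr // addr_ge0 // mulr_ge0 ?ltW //.
  by apply: le_lt_trans P10; rewrite mulr_ge0.
have [F2 [P2 run2]] := IH G' h F1 P1 h0 GG Gh F10 P10 F1f P1p.
exists F2, P2; apply: (flat_run_hit (i := i') (t := t) (s := s)) run2.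
split=> // [k|k||k].
- by case: (unliftP ord0 k) => [j|] -> //; rewrite Ff (flat_before st).
- by case: (unliftP ord0 k) => [j|] -> //; rewrite F1f (flat_after st).
- by rewrite Ff Pp (flat_hit st).
- case: (unliftP ord0 k) => [j|] -> //.
    by rewrite (inj_eq (lift_inj (h:=ord0))) Ff Pp; apply: (flat_miss st).
  by rewrite addr_gt0 // mulr_gt0.
Qed.

(** A billiard trajectory that meets a wall perpendicularly comes back along
    the same path. The hypothesis on [G] and [p] says that the velocity is
    normal to wall [ord0], up to motions that change the width of no contact, and
    [f ord0 = s * p ord0] that the trajectory left this wall a time [s] ago. So
    the run, the hit on wall [ord0] and the reversed run form a single run. *)
Lemma flat_run_double m (G : 'M[R]_m.+1) N f p f' p' s :
    (forall i, G i i = 1) ->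
    (forall j, G ord0 (lift ord0 j) * p ord0 = 2 * p (lift ord0 j)) ->
    flat_run G N f p f' p' -> 0 < s -> f ord0 = s * p ord0 ->
    (forall j, 0 < f (lift ord0 j) - s * p (lift ord0 j)) ->
  flat_run G (N + N.+1) f' (\- p') f' p'.
Proof.
move=> Gii Gp run s0 f0 fs; apply: flat_run_cat (flat_run_rev Gii run) _.
have f_gt0 := flat_run_before run.
apply: (flat_run_hit (i := ord0) (t := s) (s := s)) run.
split=> //= [|k|k|k].
- by rewrite f0 mulrN subrr.
- by case: (unliftP ord0 k) => [j|] -> //; rewrite mulrN fs.
- case: (unliftP ord0 k) => [j|] ->; last by rewrite eqxx Gii mulr1 mulr2n; ring.
  by rewrite /= mulr1n mulNr mulrC Gp; ring.
- by rewrite mulrN subrK.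
Qed.

(** The new direction [h *: x] completed to a unit vector by an orthogonal
    component is chosen so that its Gram product with [u_j] is [h * p j]; then
    the opening velocities [p j], together with [P = 2 / h] for the new contact,
    are those caused by a hit on the new wall. A small [h] keeps the
    directions nearly orthogonal, and makes [P] so large that the new contact is
    a spectator of the run given by induction. Doubling that run yields
    [2 (2 ^ m - 1) + 1] hits. *)
Lemma ruler_flat_run m : exists U : 'M[R]_m,
  [/\ U \in unitmx, forall i, (U *m U^T) i i = 1,
      forall i j, i != j -> `|(U *m U^T) i j| < 2^-1 &
      exists f p f' p', flat_run (U *m U^T) (2 ^ m - 1) f p f' p'].
Proof.
elim: m => [|m [U [Uu U1 U2 [f [p [f' [p' run]]]]]]].
  exists 1%:M; split=> [|[]//|[]//|]; first exact: unitmx1.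
  exists (fun=> 1), (fun=> 0), (fun=> 1), (fun=> 0); apply: flat_run_free.
  by move=> j; rewrite ltr01.
have [K K0 lift_run] := flat_run_lift run.
pose x := (\row_j p j) *m (invmx U)^T.
have xU : x *m U^T = \row_j p j.
  by rewrite -mulmxA -trmx_mul mulmxV // trmx1 mulmx1.
pose S := \sum_j `|p j|.
have pS j : `|p j| <= S by rewrite /S (bigD1 j) //= lerDl sumr_ge0.
have S0 : 0 <= S by rewrite sumr_ge0.
pose X := (x *m x^T) ord0 ord0.
have X0 : 0 <= X.
  by rewrite /X mxE sumr_ge0 // => k _; rewrite [X in _ * X]mxE -expr2 sqr_ge0.
(* Small enough for [h ^+ 2 * X], [h * S] and [h * (K * S)] to be below 1/2:
   the first leaves room for the orthogonal component, the second bounds the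
   Gram products, the third makes [P] exceed the threshold of [lift_run]. *)
pose h := (2 * (1 + X + S + K * S))^-1.
have KS0 : 0 <= K * S by rewrite mulr_ge0.
have C0 : 0 < 1 + X + S + K * S by lra.
have h0 : 0 < h by rewrite invr_gt0 mulr_gt0.
have hC : h * (1 + X + S + K * S) = 2^-1.
  by rewrite /h invfM -mulrA mulVf ?mulr1 // gt_eqF.
have hX : h * X < 2^-1 by nra.
have hS : h * S < 2^-1 by nra.
have hKS : h * (K * S) < 2^-1 by nra.
have h1 : h <= 2^-1 by nra.
have hX2 : 0 < 1 - h ^+ 2 * X by rewrite expr2 -mulrA; nra.
pose c := Num.sqrt (1 - h ^+ 2 * X).
have c2 : c * c = 1 - h ^+ 2 * X by rewrite -expr2 sqr_sqrtr // ltW.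
pose V : 'M[R]_(1 + m) := block_mx c%:M (h *: x) 0 U.
have VV : V *m V^T =
    block_mx 1%:M (h *: \row_j p j) (h *: \col_j p j) (U *m U^T).
  rewrite /V tr_block_mx mulmx_block !trmx0 !mul0mx !mulmx0 !add0r.
  congr block_mx.
  - rewrite tr_scalar_mx -scalar_mxM c2 [in X in _ + X]linearZ /=.
    rewrite -scalemxAr -scalemxAl scalerA.
    rewrite (mx11_scalar (x *m x^T)) -/X scale_scalar_mx -raddfD /= -expr2.
    by rewrite subrK.
  - by rewrite -scalemxAl xU.
  - rewrite linearZ /= -scalemxAr; congr (_ *: _).
    apply: trmx_inj; rewrite trmx_mul trmxK xU.
    by apply/rowP=> j; rewrite !mxE.
have e0 : (ord0 : 'I_(1 + m)) = lshift m (ord0 : 'I_1) by apply: val_inj.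
have VVd i j : (V *m V^T) (lift ord0 i) (lift ord0 j) = (U *m U^T) i j.
  by rewrite VV -!rshift1 block_mxEdr.
have VVur j : (V *m V^T) ord0 (lift ord0 j) = h * p j.
  by rewrite VV -rshift1 e0 block_mxEur !mxE.
have VVdl j : (V *m V^T) (lift ord0 j) ord0 = h * p j.
  by rewrite VV -rshift1 e0 block_mxEdl !mxE.
have VVul : (V *m V^T) ord0 ord0 = 1.
  by rewrite VV e0 block_mxEul !mxE.
have VV1 k : (V *m V^T) k k = 1.
  by case: (unliftP ord0 k) => [j|] ->; rewrite ?VVd.
have hp j : `|h * p j| <= h * S by rewrite normrM (gtr0_norm h0) ler_wpM2l // ltW.
exists V; split=> //.
- have detV : \det V = c * \det U by rewrite /V det_ublock det_scalar1.
  rewrite unitmxE detV unitrM -unitmxE Uu andbT unitfE.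
  by rewrite gt_eqF // sqrtr_gt0.
- move=> k l; case: (unliftP ord0 k) => [i|] ->; case: (unliftP ord0 l) => [j|] -> //.
  + by rewrite (inj_eq (lift_inj (h:=ord0))) VVd; apply: U2.
  + by rewrite VVdl => _; apply: le_lt_trans hS.
  + by rewrite VVur => _; apply: le_lt_trans hS.
(* The hit on the new wall happens a time [s] before the given run starts;
   extended backwards over that time, the old contacts must stay open. *)
have [s s0 fs] : exists2 s, 0 < s & forall j, 0 < f j - s * p j.
  have fS : forall j, \forall s \near (0 : R)^'+, 0 < f j - s * p j.
    move=> j.
    have : f j - s * p j @[s --> (0 : R)^'+] --> f j - 0 * p j.
      apply: cvgB; first exact: cvg_cst.
      by apply: cvgMl; apply: cvg_at_right_filter; exact: cvg_id.
    rewrite mul0r subr0 => /cvgr_gt; apply.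
    exact: (flat_run_before run).
  near ((0 : R)^'+) => s; exists s => //.
  by near: s; exact: filter_forall.
pose P := 2 / h.
have P0 : 0 < P by rewrite divr_gt0.
pose f1 k := oapp f (s * P) (unlift ord0 k).
pose p1 k := oapp p P (unlift ord0 k).
have f1l j : f1 (lift ord0 j) = f j by rewrite /f1 liftK.
have p1l j : p1 (lift ord0 j) = p j by rewrite /p1 liftK.
have f10 : f1 ord0 = s * P by rewrite /f1 unlift_none.
have p10 : p1 ord0 = P by rewrite /p1 unlift_none.
have [| | | | | | |f2 [p2 run2]] := lift_run (V *m V^T) (h * S) f1 p1.
- by rewrite mulr_ge0 // ltW.
- exact: VVd.
- by move=> i; rewrite VVdl.
- by rewrite f10 mulr_gt0.
- rewrite p10 /P ltr_pdivlMr // mulrCA; nra.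
- exact: f1l.
- exact: p1l.
have := flat_run_double VV1 _ run2 s0 _ _.
rewrite f10 p10.
have -> : (2 ^ m - 1 + (2 ^ m - 1).+1 = 2 ^ m.+1 - 1)%N.
  rewrite expnS mul2n -addnn; case: (2 ^ m)%N (expn_gt0 2 m) => // k _.
  by rewrite addSn !subSS !subn0.
move=> run3; exists f2, (\- p2), f2, p2; apply: run3 => // j.
- by rewrite VVur p1l /P mulrC mulrA divfK // gt_eqF.
- by rewrite f1l p1l.
Unshelve. all: by end_near.
Qed.

End LinearModel.

(** * Runs of hard balls and the curves they trace *)

Section Runs.
Context (R : realType) (n d : nat).
Implicit Types (q v : 'M[R]_(n, d)) (g : R -> 'M[R]_(n, d)) (i j k l : 'I_n).

Definition apart q : Prop :=
  forall i j, (i < j)%N -> 1 < enorm (row i q - row j q).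

Definition only_wall i j q : Prop :=
  [/\ (i < j)%N, wall i j q & forall k l, (k < l)%N -> (k, l) != (i, j) ->
    1 < enorm (row k q - row l q)].

Definition reflect_off i j q v : 'M[R]_(n, d) :=
  v - (2 * edot v (wall_normal i j q)) *: wall_normal i j q.

(** What one has to know of a motion of balls with finitely many collisions:
    after a time [t] balls [i] and [j] collide, and nothing else happens up to a
    time [s] later. *)
Inductive run : nat -> 'M[R]_(n, d) -> 'M[R]_(n, d) -> Prop :=
| run_free q v : apart q -> run 0 q v
| run_hit N q v i j q1 v1 t s : 0 < t -> 0 < s ->
    (forall r, 0 <= r < t -> apart (q + r *: v)) ->
    q1 = q + t *: v -> only_wall i j q1 ->
    edot v (wall_normal i j q1) != 0 -> v1 = reflect_off i j q1 v ->
    (forall r, 0 < r <= s -> apart (q1 + r *: v1)) ->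
    run N (q1 + s *: v1) v1 -> run N.+1 q v.

Lemma enorm_rowC q i j : enorm (row i q - row j q) = enorm (row j q - row i q).
Proof.
congr Num.sqrt; rewrite -opprB; apply: eq_bigr => ? _; apply: eq_bigr => ? _.
by rewrite !mxE mulrNN.
Qed.

(** Two-sided in [s], hence free of boundary cases: continuity, local linearity
    and both one-sided velocities at [t] are read off it. *)
Definition bends g t vl vr : Prop := exists2 e, 0 < e &
  forall s, `|s - t| < e -> g s = g t + (s - t) *: (if s < t then vl else vr).

Definition free_moment g t : Prop := apart (g t) /\ exists v, bends g t v v.

Definition hit_moment g t : Prop := exists i j v,
  [/\ only_wall i j (g t), edot v (wall_normal i j (g t)) != 0 &
      bends g t v (reflect_off i j (g t) v)].

Lemma bends_shift g t a vl vr :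
  bends g (t - a) vl vr -> bends (fun s => g (s - a)) t vl vr.
Proof.
move=> [e e0 ge]; exists e => // s st.
have E : s - a - (t - a) = s - t by ring.
by rewrite ge E // ltrD2r.
Qed.

Lemma bends_near g1 g2 t vl vr : {near t, g1 =1 g2} ->
  bends g1 t vl vr -> bends g2 t vl vr.
Proof.
move=> g12 [e e0 ge].
have [e' /= e'0 g12'] := g12.
exists (Num.min e e'); first by rewrite lt_min e0.
move=> s; rewrite lt_min => /andP[se se'].

have <- : g1 s = g2 s by apply: g12'; rewrite /ball_ /= distrC.
have <- : g1 t = g2 t by apply: (nbhs_singleton g12).
exact: ge.
Qed.

Lemma free_near g1 g2 t : {near t, g1 =1 g2} ->
  free_moment g1 t -> free_moment g2 t.
Proof.
move=> g12 [sep [v gv]]; split; first by rewrite -(nbhs_singleton g12).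
by exists v; apply: bends_near g12 gv.
Qed.

Lemma hit_near g1 g2 t : {near t, g1 =1 g2} ->
  hit_moment g1 t -> hit_moment g2 t.
Proof.
move=> g12 [i [j [v [ow vn gv]]]]; exists i, j, v.
by rewrite -(nbhs_singleton g12); split=> //; apply: bends_near g12 gv.
Qed.

Lemma bends_right_velocity g t vl vr : bends g t vl vr ->
  right_velocity g t = vr.
Proof.
move=> [e e0 ge]; apply: cvg_lim => //; apply: cvg_near_cst.
near=> h.
have h0 : 0 < h by near: h; exact: nbhs_right_gt.
rewrite ge; last first.
  by rewrite addrAC subrr add0r gtr0_norm //; near: h; exact: nbhs_right_lt.
rewrite ltNge lerDl (ltW h0) /= addrAC subrr add0r addrAC subrr add0r.
by rewrite scalerA mulVf ?scale1r // gt_eqF.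
Unshelve. all: by end_near. Qed.

Lemma bends_left_velocity g t vl vr : bends g t vl vr ->
  left_velocity g t = vl.
Proof.
move=> [e e0 ge]; apply: cvg_lim => //; apply: cvg_near_cst.
near=> h.
have h0 : h < 0 by near: h; exact: nbhs_left_lt.
have he : - e < h by near: h; apply: nbhs_left_gt; rewrite oppr_lt0.
rewrite ge; last by rewrite addrAC subrr add0r ltr0_norm // ltrNl.
rewrite gtrDl h0 addrAC subrr add0r addrAC subrr add0r.
by rewrite scalerA mulVf ?scale1r // lt_eqF.
Unshelve. all: by end_near. Qed.

(** With the negative and the positive part of [s - t] as coefficients, the two
    linear pieces are given by one continuous formula. *)
Lemma bends_continuous g t vl vr : bends g t vl vr -> {for t, continuous g}.
Proof.
move=> [e e0 ge].
pose lo (x : R) := (x - `|x|) / 2; pose hi (x : R) := (x + `|x|) / 2.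
have gE : \forall s \near t, g s = g t + (lo (s - t) *: vl + hi (s - t) *: vr).
  exists e => //= s; rewrite /ball_ /= distrC => /ge ->; congr (_ + _).
  rewrite /lo /hi; case: ltP => st.
    rewrite ltr0_norm ?subr_lt0 // opprK subrr mul0r scale0r addr0.
    by congr (_ *: _); field.
  rewrite ger0_norm ?subr_ge0 // subrr mul0r scale0r add0r.
  by congr (_ *: _); field.
have st : s - t @[s --> t] --> (0 : R).
  by rewrite -(subrr t); apply: cvgB; [exact: cvg_id|exact: cvg_cst].
have nst : `|s - t| @[s --> t] --> (0 : R) by rewrite -(normr0 R); exact: cvg_norm.
have lo0 : lo (s - t) @[s --> t] --> (0 - 0) / (2 : R).
  by apply: cvgMl; exact: cvgB.
have hi0 : hi (s - t) @[s --> t] --> (0 + 0) / (2 : R).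
  by apply: cvgMl; exact: cvgD.
have lim : g t + (lo (s - t) *: vl + hi (s - t) *: vr) @[s --> t]
    --> g t + ((0 - 0) / 2 *: vl + (0 + 0) / 2 *: vr).
  by apply: cvgD; [exact: cvg_cst | apply: cvgD; exact: cvgZr_tmp].
rewrite subr0 addr0 mul0r !scale0r !addr0 in lim.
rewrite /continuous_at; apply: cvg_trans lim; apply: near_eq_cvg.
exact: filterS gE.
Qed.

(** The curve is built from the end of the run backwards. Requiring it to be
    straight on the whole half-line [t <= 0] makes it possible to glue a new
    first collision in front by one case distinction, at the new collision. The
    times [ts] of the collisions are also the break points. *)
Lemma run_curve N q v : run N q v -> exists T g ts,
  [/\ 0 <= T, forall t, t <= 0 -> g t = q + t *: v,
      forall a b : R, (forall c, c \in ts -> c \notin `]a, b[) ->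
        linear_on [set` `]a, b[] g &
   [/\ forall t, 0 <= t <= T -> free_moment g t \/ (0 < t < T /\ hit_moment g t),
       uniq ts, size ts = N & forall t, t \in ts -> 0 < t < T /\ hit_moment g t]].
Proof.
elim=> [{}q {}v sep|{}N {}q {}v i j q1 v1 t s t0 s0 sep_l q1E ow hit v1E sep_r _].
  exists 0, (fun t => q + t *: v), [::]; split=> //.
    by move=> a b _; exists q, v.
  split=> // t; rewrite -eq_le => /eqP <-; left; split.
    by rewrite scale0r addr0.
  by exists v, 1 => // s _; rewrite if_same scale0r addr0 subr0.
move=> [T [g [ts [T0 g0 glin [gmom uts sts gts]]]]].
pose G (r : R) := if r <= t then q + r *: v else g (r - (t + s)).
have Gt : G t = q1 by rewrite /G lexx.
have Gmid r : t <= r <= t + s -> G r = q1 + (r - t) *: v1.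
  rewrite le_eqVlt => /andP[/predU1P[<-|tr] rs].
    by rewrite Gt subrr scale0r addr0.
  rewrite /G leNgt tr /= g0 ?subr_le0 // -addrA -scalerDl.
  by congr (_ + _ *: _); ring.
have Gnear r : t < r -> {near r, (fun x => g (x - (t + s))) =1 G}.
  move=> tr; near=> x; rewrite /G leNgt.
  have -> // : t < x.
  by near: x; exact: lt_nbhsr.
have Ghit r : 0 < r - (t + s) < T -> hit_moment g (r - (t + s)) ->
    0 < r < t + s + T /\ hit_moment G r.
  move=> rT [k [l [w [ow' wn gw]]]].
  have tr : t < r by lra.
  split; first by lra.
  apply: hit_near (Gnear _ tr) _; exists k, l, w; split=> //.
  exact: bends_shift.
have tT : 0 < t < t + s + T by lra.
have hit_t : hit_moment G t.
  exists i, j, v; rewrite Gt; split=> //; exists s => // r rs.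
  case: ltP => rt; last first.
    rewrite -v1E Gt Gmid // rt /=; move: rs; rewrite ger0_norm ?subr_ge0 //; lra.
  by rewrite Gt /G ltW // q1E -addrA -scalerDl; congr (_ + _ *: _); ring.
exists (t + s + T), G, (t :: map (+%R (t + s)) ts); split.
- by lra.
- by move=> r r0; rewrite /G (le_trans r0 (ltW t0)).
- move=> a b nob.
  case: (leP b t) => [bt|tb].
    exists q, v => r; rewrite /= in_itv /= => /andP[_ rb].
    by rewrite /G ltW // (lt_le_trans rb).
  have ta : t <= a.
    have := nob t; rewrite mem_head in_itv /= tb andbT -leNgt; exact.
  have [|a' [w gw]] := glin (a - (t + s)) (b - (t + s)).
    move=> c cts; have := nob (t + s + c).
    rewrite inE map_f // orbT !in_itv /= => /(_ isT).
    by apply: contra => /andP[? ?]; apply/andP; split; lra.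
  exists (a' - (t + s) *: w), w => r; rewrite /= in_itv /= => /andP[ar rb].
  rewrite /G leNgt (le_lt_trans ta ar) /= gw /=; last by rewrite in_itv /=; lra.
  by rewrite scalerBl; rewrite -[RHS]addrA [- _ + _]addrC.
split.
- move=> r /andP[r0 rT]; case: (ltgtP r t) => [rt|tr|->]; last by right.
    left; split; first by rewrite /G ltW //; apply: sep_l; rewrite r0.
    exists v, (t - r); rewrite ?subr_gt0 // => x xr.
    have xt : x < t by move: xr; rewrite ltr_norml; lra.
    by rewrite if_same /G !ltW // -addrA -scalerDl; congr (_ + _ *: _); ring.
  case: (ltP r (t + s)) => rs.
    left; split; first by rewrite Gmid ?ltW //; apply: sep_r; lra.
    exists v1, (Num.min (r - t) (t + s - r)); first by rewrite lt_min !subr_gt0 tr.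
    move=> x; rewrite lt_min !ltr_norml => /andP[/andP[? ?] /andP[? ?]].
    have xt : t <= x <= t + s by lra.
    have rt : t <= r <= t + s by lra.
    rewrite if_same (Gmid x xt) (Gmid r rt).
    by rewrite -addrA -scalerDl; congr (_ + _ *: _); ring.
  have /gmom[[sep [w gw]]|[rT' hr]] : 0 <= r - (t + s) <= T by lra.
  left; apply: free_near (Gnear _ tr) _; split=> //; exists w.
    exact: bends_shift.
  by right; exact: Ghit.
- rewrite /= map_inj_uniq ?uts ?andbT; last exact: addrI.
  by apply/negP => /mapP[c /gts[+ _] tc]; lra.
- by rewrite /= size_map sts.
- move=> r; rewrite inE => /predU1P[->//|/mapP[c /gts[cT hc] rc]].
  have E : r - (t + s) = c by rewrite rc; ring.
  by apply: Ghit; rewrite E.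
Unshelve. all: by end_near. Qed.

Lemma only_wall_config i j q k l : only_wall i j q -> k != l ->
  1 <= enorm (row k q - row l q).
Proof.
move=> [ij wij sep].
wlog kl : k l / (k < l)%N => [H kl|_].
  have := kl; rewrite -val_eqE neq_ltn => /orP[lt|lt]; first exact: H.
  by rewrite enorm_rowC; apply: H => //; rewrite eq_sym.
case: (eqVneq (k, l) (i, j)) => [[-> ->]|ne]; first by rewrite wij.
by rewrite ltW // sep.
Qed.

Lemma apart_config q k l : apart q -> k != l ->
  1 <= enorm (row k q - row l q).
Proof.
move=> sep; rewrite -val_eqE neq_ltn => /orP[lt|lt]; last rewrite enorm_rowC.
all: by rewrite ltW // sep.
Qed.

Lemma only_wall_uniq i j q k l : only_wall i j q -> (k < l)%N -> wall k l q ->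
  (k, l) = (i, j).
Proof.
move=> [ij wij sep] kl wkl; apply/eqP; apply: contraT => /(sep _ _ kl).
by rewrite wkl ltxx.
Qed.

Lemma apart_wall q k l : apart q -> (k < l)%N -> ~ wall k l q.
Proof. by move=> /[apply] + w; rewrite w ltxx. Qed.

Lemma run_MaxCol N q v : run N q v -> MaxCol_ge R n d N.
Proof.
move=> /run_curve[T [g [ts [T0 g0 glin [gmom uts sts gts]]]]].
have inside t : 0 < t < T -> [set` `[0, T]]° t.
  by move=> tT; rewrite interior_itv_bnd /= in_itv.
exists `[0, T], g; split; last first.
  exists ts; split=> // t /gts[tT [i [j [w [ow wn gw]]]]]; split; first exact: inside.
  exists i, j; rewrite (bends_left_velocity gw).
  by case: ow.
have mom t : t \in `[0, T] -> free_moment g t \/ (0 < t < T /\ hit_moment g t).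
  by rewrite in_itv; exact: gmom.
split.
- apply: continuous_in_subspaceT => t; rewrite inE => /mom.
  by move=> [[_ [w]]|[_ [i [j [w [_ _]]]]]] /bends_continuous.
- by exists ts => a b _ _; exact: glin.
- move=> t /mom [[sep _]|[_ [i [j [w [ow _ _]]]]]] k l kl.
    exact: apart_config.
  exact: only_wall_config ow _.
- move=> t /mom [[sep _]|[_ [i [j [w [ow _ _]]]]]] k l k' l' kl kl' wkl wkl'.
    by have := apart_wall sep kl wkl.
  have := only_wall_uniq ow kl wkl; have := only_wall_uniq ow kl' wkl'.
  by move=> <- [-> ->].
- move=> t /mom [[_ [w [e e0 gw]]] _|[_ [i [j [w [[ij wij _] _ _]]]]]]; last first.
    by move=> /(_ _ _ ij)/(_ wij).
  exists [set s | `|s - t| < e].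
    by exists e => //= s; rewrite /ball_ /= distrC.
  exists (g t - t *: w), w => s [_ /= /gw ->].
  by rewrite if_same scalerBl -[RHS]addrA [- _ + _]addrC.
- move=> t /mom [[sep _]|[tT [i [j [w [ow wn gw]]]]]] k l kl wkl.
    by have := apart_wall sep kl wkl.
  have [-> ->] := only_wall_uniq ow kl wkl.
  split; first exact: inside.
  by rewrite (bends_left_velocity gw) (bends_right_velocity gw).
Qed.

End Runs.

(** * Euclidean computations *)

Section Euclidean.
Context (R : realType).

Lemma edotC a b (A B : 'M[R]_(a, b)) : edot A B = edot B A.
Proof. by apply: eq_bigr => i _; apply: eq_bigr => j _; rewrite mulrC. Qed.

Lemma edotDl a b (A B C : 'M[R]_(a, b)) : edot (A + B) C = edot A C + edot B C.
Proof.
rewrite /edot -big_split; apply: eq_bigr => i _.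
by rewrite -big_split; apply: eq_bigr => j _; rewrite mxE mulrDl.
Qed.

Lemma edotZl a b r (A B : 'M[R]_(a, b)) : edot (r *: A) B = r * edot A B.
Proof.
rewrite /edot mulr_sumr; apply: eq_bigr => i _.
by rewrite mulr_sumr; apply: eq_bigr => j _; rewrite mxE mulrA.
Qed.

Lemma edotDr a b (A B C : 'M[R]_(a, b)) : edot A (B + C) = edot A B + edot A C.
Proof. by rewrite edotC edotDl !(edotC _ A). Qed.

Lemma edotZr a b r (A B : 'M[R]_(a, b)) : edot A (r *: B) = r * edot A B.
Proof. by rewrite edotC edotZl (edotC _ A). Qed.

Lemma edotNl a b (A B : 'M[R]_(a, b)) : edot (- A) B = - edot A B.
Proof. by rewrite -scaleN1r edotZl mulN1r. Qed.

Lemma edotNr a b (A B : 'M[R]_(a, b)) : edot A (- B) = - edot A B.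
Proof. by rewrite edotC edotNl edotC. Qed.

Definition edotE := (edotDl, edotDr, edotNl, edotNr, edotZl, edotZr).

Lemma edot_ge0 a b (A : 'M[R]_(a, b)) : 0 <= edot A A.
Proof. by do 2!apply: sumr_ge0 => ? _; rewrite -expr2 sqr_ge0. Qed.

Lemma edot_row a b c (A : 'M[R]_(a, b)) (B : 'M[R]_(c, b)) i j :
  edot (row i A) (row j B) = (A *m B^T) i j.
Proof. by rewrite /edot big_ord1 mxE; apply: eq_bigr => k _; rewrite !mxE. Qed.

Lemma enorm_gt1 a b (A : 'M[R]_(a, b)) : (1 < enorm A) = (1 < edot A A).
Proof.
rewrite /enorm -[X in X < Num.sqrt _](@sqrtr1 R).
case: (ltP 0 (edot A A)) => A0; first by rewrite ltr_sqrt.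
by rewrite (ler0_sqrtr A0) sqrtr1 !ltNge ler01 (le_trans A0 ler01).
Qed.

Lemma enorm_eq1 a b (A : 'M[R]_(a, b)) : edot A A = 1 -> enorm A = 1.
Proof. by rewrite /enorm => ->; rewrite sqrtr1. Qed.

Definition gap a b (i j : 'I_a) (q : 'M[R]_(a, b)) := row i q - row j q.

Lemma gapD a b (i j : 'I_a) (p q : 'M[R]_(a, b)) :
  gap i j (p + q) = gap i j p + gap i j q.
Proof. by rewrite /gap !linearD /= addrACA. Qed.

Lemma gapZ a b (i j : 'I_a) r (q : 'M[R]_(a, b)) :
  gap i j (r *: q) = r *: gap i j q.
Proof. by rewrite /gap scalerBr !linearZ. Qed.

Lemma wall_normalE a b (i j k : 'I_a) (q : 'M[R]_(a, b)) : i != j ->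
  row k (wall_normal i j q) =
    ((Num.sqrt 2)^-1 * ((k == i)%:R - (k == j)%:R)) *: gap i j q.
Proof.
move=> ij; rewrite rowK /gap; case: (eqVneq k i) => [->|ki].
  by rewrite (negPf ij) subr0 mulr1.
case: (eqVneq k j) => _; last by rewrite subrr mulr0 scale0r.
by rewrite sub0r mulrN1 scaleNr -scalerN opprB.
Qed.

Lemma edot_normal a b (i j : 'I_a) (v q : 'M[R]_(a, b)) : i != j ->
  edot v (wall_normal i j q) =
    (Num.sqrt 2)^-1 * edot (gap i j v) (gap i j q).
Proof.
move=> ij; set c := _^-1.
have -> : edot v (wall_normal i j q) =
    \sum_k edot (row k v) (row k (wall_normal i j q)).
  by apply: eq_bigr => k _; rewrite /edot big_ord1; apply: eq_bigr => l _; rewrite !mxE.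
under eq_bigr do rewrite wall_normalE // edotZr.
have ji : j != i by rewrite eq_sym.
rewrite (bigD1 i) // (bigD1 j) //= big1 => [|k /andP[ki kj]].
  by rewrite !eqxx (negPf ij) (negPf ji) {3}/gap edotDl edotNl -/c /= mulr1n mulr0n; ring.
by rewrite (negPf ki) (negPf kj) subrr mulr0 mul0r.
Qed.

(** On a wall, the unit normal has two blocks of length [(Num.sqrt 2)^-1], so
    the reflection exchanges the velocity components of balls [i] and [j] along the
    line of centers; the integer coefficient records which ends of the pair
    [(k, l)] are affected. *)
Lemma gap_reflect_off a b (i j k l : 'I_a) (q v : 'M[R]_(a, b)) : i != j ->
  gap k l (reflect_off i j q v) = gap k l v -
    (edot (gap i j v) (gap i j q) *
      ((k == i)%:R - (k == j)%:R - (l == i)%:R + (l == j)%:R)) *: gap i j q.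
Proof.
move=> ij; rewrite /reflect_off -scaleNr gapD gapZ; congr (_ + _).
rewrite {1}/gap !wall_normalE // edot_normal // -scalerBl scalerA -[in RHS]scaleNr.
congr (_ *: _).
have s2 : (Num.sqrt 2)^-1 * (Num.sqrt 2)^-1 = 2^-1 :> R.
  by rewrite -invfM -expr2 sqr_sqrtr.
set c := _^-1 in s2 *; set x := edot _ _.
rewrite -mulrBr mulNr -!mulrA !(mulrCA c) (mulrA c c) s2.
by field.
Qed.

Lemma reflect_offZ a b (i j : 'I_a) (q v : 'M[R]_(a, b)) r :
  reflect_off i j q (r *: v) = r *: reflect_off i j q v.
Proof.
by rewrite /reflect_off edotZl scalerBr scalerA; congr (_ - _ *: _); ring.
Qed.

(** A convex quadratic lies above its tangent at the start, so this gives a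
    test for distances to stay large along a segment that is stable under small
    perturbations. *)
Lemma affine_gt0 (c b T r : R) : 0 < c -> 0 < c + T * b -> 0 <= r <= T ->
  0 < c + r * b.
Proof.
move=> c0 cT /andP[r0 rT].
case: (leP 0 b) => b0; first by rewrite ltr_wpDr // mulr_ge0.
by apply: lt_le_trans cT _; rewrite lerD2l ler_wnM2r // ltW.
Qed.

(** The first positive root, in the form that remains meaningful and continuous in
    [a] when [a] tends to 0; the last conclusion says that the root is crossed
    with nonzero speed. *)
Lemma quadratic_root (a b c : R) : 0 < c -> b < 0 -> 0 < b ^+ 2 - 4 * a * c ->
  let T := 2 * c / (Num.sqrt (b ^+ 2 - 4 * a * c) - b) in
  [/\ 0 < T, c + T * b + T ^+ 2 * a = 0 & b + 2 * T * a < 0].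
Proof.
move=> c0 b0 D0 T.
have s2 := sqr_sqrtr (ltW D0).
have s0 : 0 < Num.sqrt (b ^+ 2 - 4 * a * c) by rewrite sqrtr_gt0.
move: @T s2 s0; set s := Num.sqrt _ => T s2 s0.
have sb : 0 < s - b by lra.
have TE : T * (s - b) = 2 * c by rewrite /T divfK // gt_eqF.
have D : 4 * a * c = b ^+ 2 - s ^+ 2 by rewrite s2; ring.
have bT : b + 2 * T * a = - s.
  apply: (mulIf (lt0r_neq0 sb)).
  rewrite (_ : (b + 2 * T * a) * (s - b) =
    b * (s - b) + 2 * a * (T * (s - b))); last by ring.
  have -> : 2 * a * (T * (s - b)) = b ^+ 2 - s ^+ 2 by rewrite TE -D; ring.
  by ring.
split; last by rewrite bT oppr_lt0.
  by rewrite divr_gt0 // mulr_gt0.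
apply: (@mulfI _ 2); first by rewrite pnatr_eq0.
rewrite (_ : 2 * _ = 2 * c + T * (b + (b + 2 * T * a))); last by ring.
by rewrite bT -TE; ring.
Qed.

End Euclidean.

(** * Limits as the scale shrinks to zero *)

Section EntrywiseLimits.
Context (R : realType) (a b : nat).
Implicit Types (Y V : R -> 'M[R]_(a, b)) (y v : 'M[R]_(a, b)).

(** Entrywise, since all that is ever evaluated is a polynomial or a root in
    the entries. *)
Definition tends Y y := forall i j, Y e i j @[e --> (0 : R)^'+] --> y i j.

Lemma tends_cst y : tends (fun=> y) y.
Proof. by move=> i j; exact: cvg_cst. Qed.

Lemma tendsD Y y V v : tends Y y -> tends V v ->
  tends (fun e => Y e + V e) (y + v).
Proof.
move=> Yy Vv i j; rewrite mxE.
by under eq_fun do rewrite mxE; apply: cvgD; [exact: Yy | exact: Vv].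
Qed.

Lemma tendsZ (r : R -> R) (r0 : R) Y y : r e @[e --> (0 : R)^'+] --> r0 -> tends Y y ->
  tends (fun e => r e *: Y e) (r0 *: y).
Proof.
move=> rr Yy i j; rewrite mxE.
by under eq_fun do rewrite mxE; apply: cvgM => //; exact: Yy.
Qed.

Lemma tendsB Y y V v : tends Y y -> tends V v ->
  tends (fun e => Y e - V e) (y - v).
Proof.
move=> Yy Vv i j; rewrite !mxE.
by under eq_fun do rewrite !mxE; apply: cvgB; [exact: Yy | exact: Vv].
Qed.

Lemma cvg_edot Y y V v : tends Y y -> tends V v ->
  edot (Y e) (V e) @[e --> (0 : R)^'+] --> edot y v.
Proof.
move=> Yy Vv; apply: cvg_big => [|i _]; first exact: add_continuous.
apply: cvg_big => [|j _]; first exact: add_continuous.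
by apply: cvgM; [exact: Yy | exact: Vv].
Qed.

Lemma cvg_right0 : e @[e --> (0 : R)^'+] --> (0 : R).
Proof. by apply: cvg_at_right_filter; exact: cvg_id. Qed.

End EntrywiseLimits.

Lemma tends_gap (R : realType) a b (i j : 'I_a) (Y : R -> 'M[R]_(a, b)) y :
  tends Y y -> tends (fun e => gap i j (Y e)) (gap i j y).
Proof.
move=> Yy k l; rewrite !mxE.
by under eq_fun do rewrite !mxE; apply: cvgB; exact: Yy.
Qed.

Lemma tends_reflect_off (R : realType) a b (i j : 'I_a) (Q V : R -> 'M[R]_(a, b)) q v :
  i != j -> tends Q q -> tends V v ->
  tends (fun e => reflect_off i j (Q e) (V e)) (reflect_off i j q v).
Proof.
move=> ij Qq Vv; have Nn : tends (fun e => wall_normal i j (Q e)) (wall_normal i j q).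
  have E q' k l : wall_normal i j q' k l =
      (Num.sqrt 2)^-1 * ((k == i)%:R - (k == j)%:R) * (gap i j q' 0 l) :> R.
    by have /rowP/(_ l) := wall_normalE k q' ij; rewrite mxE => ->; rewrite mxE.
  move=> k l; rewrite E; under eq_fun do rewrite E.
  by apply: cvgM; [exact: cvg_cst | exact: tends_gap].
apply: tendsB => //; apply: tendsZ => //.
by apply: cvgM; [exact: cvg_cst | exact: cvg_edot].
Qed.

(** * Bending the hyperplanes back into walls *)

Section Star.
Context (R : realType) (m : nat) (U : 'M[R]_m).
Context (Uunit : forall i, (U *m U^T) i i = 1).
Context (Usep : forall i j, i != j -> `|(U *m U^T) i j| < 2^-1).
Implicit Types (y v : 'M[R]_(m.+1, m)) (j k : 'I_m).

Local Notation spoke j := (lift ord0 j).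

(** The hub is at the origin and satellite [j] at [- u_j], where the [u_j] are
    the rows of [U]. Nearby configurations are written [star + e *: y] with
    [e > 0] small, and velocities [e *: v], so that times do not depend on
    [e]. *)
Definition star : 'M[R]_(m.+1, m) :=
  \matrix_k oapp (fun j => - row j U) 0 (unlift ord0 k).

Lemma gap_star0 j : gap ord0 (spoke j) star = row j U.
Proof. by rewrite /gap !rowK unlift_none liftK /= sub0r opprK. Qed.

Lemma gap_star j k : gap (spoke j) (spoke k) star = row k U - row j U.
Proof. by rewrite /gap !rowK !liftK /= opprK addrC. Qed.

(** The width of contact [j] if [y] is a displacement, and its opening velocity
    if [y] is a velocity, in the limit [e = 0] where walls are flat. *)
Definition along y j := edot (row j U) (gap ord0 (spoke j) y).

(** The squared distance of hub and satellite is [1 + 2 * e * clearance], by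
    which the curved wall becomes a perturbation of order [e] of the
    hyperplane [along y j = 0]. *)
Definition clearance (e : R) y j :=
  along y j + e / 2 * edot (gap ord0 (spoke j) y) (gap ord0 (spoke j) y).

(** The derivative of [clearance] at [y] in the direction [v]. *)
Definition drift (e : R) y v j :=
  edot (gap ord0 (spoke j) (star + e *: y)) (gap ord0 (spoke j) v).

Lemma spoke_dist e y j :
  edot (gap ord0 (spoke j) (star + e *: y)) (gap ord0 (spoke j) (star + e *: y)) =
  1 + 2 * e * clearance e y j.
Proof.
rewrite gapD gapZ gap_star0 /clearance /along.
move: (gap _ _ y) => z; rewrite !edotE (edotC z) edot_row Uunit.
by field.
Qed.

Lemma clearance_line e y v j r : clearance e (y + r *: v) j =
  clearance e y j + r * drift e y v j +
    r ^+ 2 * (e / 2 * edot (gap ord0 (spoke j) v) (gap ord0 (spoke j) v)).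
Proof.
rewrite /clearance /along /drift !gapD !gapZ gap_star0.
move: (gap _ _ y) (gap _ _ v) => z w.
by rewrite !edotE (edotC w z); field.
Qed.

Lemma drift_line e y v j r : drift e (y + r *: v) v j = drift e y v j +
    2 * r * (e / 2 * edot (gap ord0 (spoke j) v) (gap ord0 (spoke j) v)).
Proof.
rewrite /drift !gapD !gapZ !gapD !gapZ.
move: (gap _ _ y) (gap _ _ v) (gap _ _ star) => z w u.
by rewrite !edotE; field.
Qed.

(** Satellites do not touch each other in [star], so here, unlike in
    [clearance], no rescaling by [e] takes place. *)
Definition spoke_sep (e : R) y j k :=
  edot (gap (spoke j) (spoke k) (star + e *: y))
       (gap (spoke j) (spoke k) (star + e *: y)) - 1.

Definition spoke_sep_drift (e : R) y v j k :=
  2 * e * edot (gap (spoke j) (spoke k) (star + e *: y)) (gap (spoke j) (spoke k) v).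

Lemma spoke_sep_line e y v j k r : spoke_sep e (y + r *: v) j k =
  spoke_sep e y j k + r * spoke_sep_drift e y v j k +
    r ^+ 2 * (e ^+ 2 * edot (gap (spoke j) (spoke k) v) (gap (spoke j) (spoke k) v)).
Proof.
rewrite /spoke_sep /spoke_sep_drift scalerDr addrA !gapD !gapZ.
move: (gap _ _ star + _) (gap _ _ v) => z w.
by rewrite !edotE (edotC w z); ring.
Qed.

Lemma apart_star e y : 0 < e -> (forall j, 0 < clearance e y j) ->
  (forall j k, (j < k)%N -> 0 < spoke_sep e y j k) -> apart (star + e *: y).
Proof.
move=> e0 cl sp a b.
case: (unliftP ord0 b) => [k|] ->; last by rewrite ltn0.
case: (unliftP ord0 a) => [j|] ->; rewrite enorm_gt1 -/(gap _ _ _).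
  by rewrite /= ltnS => /sp; rewrite /spoke_sep subr_gt0.
by rewrite spoke_dist => _; rewrite ltrDl !mulr_gt0.
Qed.

Lemma only_wall_star e y i : 0 < e -> clearance e y i = 0 ->
  (forall j, j != i -> 0 < clearance e y j) ->
  (forall j k, (j < k)%N -> 0 < spoke_sep e y j k) ->
  only_wall ord0 (spoke i) (star + e *: y).
Proof.
move=> e0 ci cl sp; split=> // [|a b].
  by apply: enorm_eq1; rewrite -/(gap _ _ _) spoke_dist ci mulr0 addr0.
case: (unliftP ord0 b) => [k|] ->; last by rewrite ltn0.
case: (unliftP ord0 a) => [j|] ->; rewrite enorm_gt1 -/(gap _ _ _).
  by rewrite /= ltnS => /sp; rewrite /spoke_sep subr_gt0.
move=> _; rewrite xpair_eqE eqxx (inj_eq (lift_inj (h:=ord0))) => ki.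
by rewrite spoke_dist ltrDl !mulr_gt0 // cl.
Qed.

Lemma cvg_along (Y : R -> 'M[R]_(m.+1, m)) y j : tends Y y ->
  along (Y e) j @[e --> (0 : R)^'+] --> along y j.
Proof. by move=> Yy; apply: cvg_edot; [exact: tends_cst | exact: tends_gap]. Qed.

Lemma cvg_clearance (Y : R -> 'M[R]_(m.+1, m)) y j : tends Y y ->
  clearance e (Y e) j @[e --> (0 : R)^'+] --> along y j.
Proof.
move=> Yy; rewrite -[X in _ --> X]addr0; apply: cvgD; first exact: cvg_along.
rewrite -[X in _ --> X](mul0r (edot (gap ord0 (spoke j) y) (gap ord0 (spoke j) y))).
apply: cvgM; last by apply: cvg_edot; exact: tends_gap.
by rewrite -[X in _ --> X](mul0r 2^-1); apply: cvgMl; exact: cvg_right0.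
Qed.

Lemma tends_star (Y : R -> 'M[R]_(m.+1, m)) y : tends Y y ->
  tends (fun e => star + e *: Y e) star.
Proof.
move=> Yy; rewrite -[X in tends _ X]addr0 -(scale0r y).
have cst : tends (fun=> star) star by exact: tends_cst.
by apply: (tendsD cst); apply: (@tendsZ _ _ _ id) => //; exact: cvg_right0.
Qed.

Lemma cvg_drift (Y V : R -> 'M[R]_(m.+1, m)) y v j : tends Y y -> tends V v ->
  drift e (Y e) (V e) j @[e --> (0 : R)^'+] --> along v j.
Proof.
move=> Yy Vv; rewrite /along -gap_star0; apply: cvg_edot; apply: tends_gap => //.
exact: tends_star Yy.
Qed.

(** Unit vectors with Gram product below 1/2 are more than 1 apart. *)
Lemma spoke_sep_star j k : j != k ->
  0 < edot (gap (spoke j) (spoke k) star) (gap (spoke j) (spoke k) star) - 1.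
Proof.
move=> jk; rewrite gap_star !edotE (edotC (row k U)) !edot_row !Uunit.
by have := Usep jk; rewrite ltr_norml => /andP[_]; lra.
Qed.

Lemma cvg_spoke_sep (Y : R -> 'M[R]_(m.+1, m)) y j k : tends Y y ->
  spoke_sep e (Y e) j k @[e --> (0 : R)^'+] -->
    edot (gap (spoke j) (spoke k) star) (gap (spoke j) (spoke k) star) - 1.
Proof.
move=> Yy; apply: cvgB; last exact: cvg_cst.
by apply: cvg_edot; apply: tends_gap; exact: tends_star Yy.
Qed.

Lemma cvg_spoke_sep_drift (Y V : R -> 'M[R]_(m.+1, m)) y v j k :
    tends Y y -> tends V v ->
  spoke_sep_drift e (Y e) (V e) j k @[e --> (0 : R)^'+] --> (0 : R).
Proof.
move=> Yy Vv.
rewrite -[X in _ --> X](mul0r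
  (edot (gap (spoke j) (spoke k) star) (gap (spoke j) (spoke k) v))).
apply: cvgM; last by apply: cvg_edot; apply: tends_gap => //; exact: tends_star Yy.
by rewrite -[X in _ --> X](mulr0 2); apply: cvgMr; exact: cvg_right0.
Qed.

Lemma clearance_line_gt0 e y v T j r : 0 <= e -> 0 < clearance e y j ->
  0 < clearance e y j + T * drift e y v j -> 0 <= r <= T ->
  0 < clearance e (y + r *: v) j.
Proof.
move=> e0 c0 cT rT; rewrite clearance_line ltr_pwDl //; first exact: affine_gt0 rT.
by rewrite mulr_ge0 ?sqr_ge0 // mulr_ge0 ?divr_ge0 // edot_ge0.
Qed.

Lemma spoke_sep_line_gt0 e y v T j k r : 0 < spoke_sep e y j k ->
  0 < spoke_sep e y j k + T * spoke_sep_drift e y v j k -> 0 <= r <= T ->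
  0 < spoke_sep e (y + r *: v) j k.
Proof.
move=> c0 cT rT; rewrite spoke_sep_line ltr_pwDl //; first exact: affine_gt0 rT.
by rewrite mulr_ge0 ?sqr_ge0 // mulr_ge0 ?sqr_ge0 // edot_ge0.
Qed.

(** At [e = 0] the reflection of balls is the rule of the flat model. *)
Lemma along_reflect v i j : along (reflect_off ord0 (spoke i) star v) j =
  along v j - along v i * (U *m U^T) i j *+ (i == j).+1.
Proof.
rewrite /along gap_reflect_off ?neq_lift // gap_star0 eqxx.
rewrite (inj_eq (lift_inj (h:=ord0))) (negPf (neq_lift _ _)) (eq_sym _ ord0).
rewrite (negPf (neq_lift _ _)) (eq_sym j i) [edot (gap _ _ v) _]edotC.
move: (gap _ (spoke j) v) (gap _ (spoke i) v) => w z.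
rewrite edotDr edotNr edotZr (edotC (row j U) (row i U)) edot_row.
by case: (i == j) => /=; rewrite ?mulr1n ?mulr0n ?mulr2n; ring.
Qed.

Lemma near_cvg_gt0 (F : R -> R) (l : R) : F e @[e --> (0 : R)^'+] --> l -> 0 < l ->
  \forall e \near (0 : R)^'+, 0 < F e.
Proof. by move=> /cvgr_gt; apply. Qed.

Lemma near_spoke_sep Y V y v (T : R -> R) (t : R) : tends Y y -> tends V v ->
  T e @[e --> (0 : R)^'+] --> t ->
  \forall e \near (0 : R)^'+, forall j k, (j < k)%N -> 0 < spoke_sep e (Y e) j k /\
     0 < spoke_sep e (Y e) j k + T e * spoke_sep_drift e (Y e) (V e) j k.
Proof.
move=> Yy Vv Tt.
suff H j k : \forall e \near (0 : R)^'+, (j < k)%N -> 0 < spoke_sep e (Y e) j k /\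
     0 < spoke_sep e (Y e) j k + T e * spoke_sep_drift e (Y e) (V e) j k.
  by apply: filter_forall => j; apply: filter_forall => k; exact: H.
case: (ltnP j k) => jk; last by near=> e.
have l0 := @spoke_sep_star j k (negbT (ltn_eqF jk)).
have s0 := cvg_spoke_sep (j := j) (k := k) Yy.
have s1 : spoke_sep e (Y e) j k + T e * spoke_sep_drift e (Y e) (V e) j k
      @[e --> (0 : R)^'+] -->
    edot (gap (spoke j) (spoke k) star) (gap (spoke j) (spoke k) star) - 1 + t * 0.
  by apply: cvgD => //; apply: cvgM => //; exact: cvg_spoke_sep_drift Yy Vv.
rewrite mulr0 addr0 in s1.
have n0 := near_cvg_gt0 s0 l0; have n1 := near_cvg_gt0 s1 l0.
by near=> e => _; split; [near: e; exact: n0 | near: e; exact: n1].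
Unshelve. all: by end_near. Qed.

Lemma near_clearance (P : pred 'I_m) Y V y v (T : R -> R) (t : R) :
  tends Y y -> tends V v -> T e @[e --> (0 : R)^'+] --> t ->
  (forall j, P j -> 0 < along y j /\ 0 < along y j + t * along v j) ->
  \forall e \near (0 : R)^'+, forall j, P j -> 0 < clearance e (Y e) j /\
     0 < clearance e (Y e) j + T e * drift e (Y e) (V e) j.
Proof.
move=> Yy Vv Tt ypos; apply: filter_forall => j.
case: (boolP (P j)) => [/ypos[l0 l1]|_]; last by near=> e.
have s0 := cvg_clearance (j := j) Yy.
have s1 : clearance e (Y e) j + T e * drift e (Y e) (V e) j @[e --> (0 : R)^'+] -->
    along y j + t * along v j.
  by apply: cvgD => //; apply: cvgM => //; exact: cvg_drift Yy Vv.
have n0 := near_cvg_gt0 s0 l0; have n1 := near_cvg_gt0 s1 l1.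
by near=> e => _; split; [near: e; exact: n0 | near: e; exact: n1].
Unshelve. all: by end_near. Qed.

Lemma near_apart Y y : tends Y y -> (forall j, 0 < along y j) ->
  \forall e \near (0 : R)^'+, apart (star + e *: Y e).
Proof.
move=> Yy ypos.
have T0 : (fun=> 0 : R) e @[e --> (0 : R)^'+] --> (0 : R) by exact: cvg_cst.
have n0 := near_spoke_sep Yy Yy T0.
have n1 : \forall e \near (0 : R)^'+, forall j, xpredT j -> 0 < clearance e (Y e) j /\
     0 < clearance e (Y e) j + 0 * drift e (Y e) (Y e) j.
  by apply: (near_clearance Yy Yy T0) => j _; rewrite mul0r addr0.
near=> e; apply: apart_star => // [j|j k jk].
- suff /(_ j isT)[] : forall j, xpredT j -> 0 < clearance e (Y e) j /\
     0 < clearance e (Y e) j + 0 * drift e (Y e) (Y e) j by [].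
  by near: e.
- suff /(_ j k jk)[] : forall j k, (j < k)%N -> 0 < spoke_sep e (Y e) j k /\
     0 < spoke_sep e (Y e) j k + 0 * spoke_sep_drift e (Y e) (Y e) j k by [].
  by near: e.
Unshelve. all: by end_near. Qed.

(** The conditions on [y1] and [v1] are of the same kind as those on [y] and
    [v], tests at both ends of a segment as in [affine_gt0]. Contact [i] itself
    needs none: its clearance is convex along either segment and vanishes at
    the hit, so the sign of its slope there decides. *)
Lemma run_hit_star e i y v y1 v1 T s N : 0 < e -> 0 < T -> 0 < s ->
  clearance e (y + T *: v) i = 0 -> drift e (y + T *: v) v i < 0 ->
  (forall j, j != i -> 0 < clearance e y j /\
     0 < clearance e y j + T * drift e y v j) ->
  (forall j k, (j < k)%N -> 0 < spoke_sep e y j k /\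
     0 < spoke_sep e y j k + T * spoke_sep_drift e y v j k) ->
  y1 = y + T *: v -> v1 = reflect_off ord0 (spoke i) (star + e *: y1) v ->
  (forall j, j != i -> 0 < clearance e y1 j /\
     0 < clearance e y1 j + s * drift e y1 v1 j) ->
  (forall j k, (j < k)%N -> 0 < spoke_sep e y1 j k /\
     0 < spoke_sep e y1 j k + s * spoke_sep_drift e y1 v1 j k) ->
  run N (star + e *: (y1 + s *: v1)) (e *: v1) ->
  run N.+1 (star + e *: y) (e *: v).
Proof.
move=> e0 T0 s0 hit coming cl0 sp0 y1E v1E cl1 sp1 next.
rewrite -y1E in hit coming.
have scaled q w r : star + e *: q + r *: (e *: w) = star + e *: (q + r *: w).
  by rewrite scalerDr addrA !scalerA mulrC.
have a0 w : 0 <= e / 2 * edot (gap ord0 (spoke i) w) (gap ord0 (spoke i) w).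
  by rewrite mulr_ge0 ?edot_ge0 // divr_ge0 // ltW.
have Ti : 0 <= T <= T by rewrite lexx ltW.
have bounce : drift e y1 v1 i = - drift e y1 v i.
  have d1 := spoke_dist e y1 i; rewrite hit mulr0 addr0 in d1.
  rewrite /drift v1E gap_reflect_off ?neq_lift // eqxx.
  rewrite (negPf (neq_lift _ _)) (eq_sym _ ord0) (negPf (neq_lift _ _)) eqxx.
  move: d1; move: (gap _ _ (star + _)) (gap _ _ v) => n w d1.
  by rewrite !edotE d1 (edotC w n) /=; ring.
apply: (run_hit (i := ord0) (j := spoke i) T0 s0 (q1 := star + e *: y1) (v1 := e *: v1)).
- move=> r /andP[r0 rT]; rewrite scaled.
  have rT' : 0 <= r <= T by rewrite r0 ltW.
  apply: (apart_star e0) => [j|j k /sp0[? ?]]; last exact: spoke_sep_line_gt0 rT'.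
  case: (eqVneq j i) => [->|/cl0[? ?]]; last exact: clearance_line_gt0 (ltW e0) _ _ rT'.
  have -> : y + r *: v = y1 + (r - T) *: v.
    by rewrite y1E -addrA -scalerDl; congr (_ + _ *: _); ring.
  rewrite clearance_line hit add0r ltr_pwDl //; last by rewrite mulr_ge0 ?sqr_ge0.
  by rewrite nmulr_rgt0 // subr_lt0.
- by rewrite scaled -y1E.
- apply: (only_wall_star e0) => // [j /cl1[]//|j k /sp1[]//].
- rewrite edot_normal ?neq_lift // gapZ edotZl edotC -/(drift e y1 v i).
  apply: mulf_neq0; first by rewrite gt_eqF // invr_gt0 sqrtr_gt0.
  by apply: mulf_neq0; [rewrite gt_eqF | rewrite lt_eqF].
- by rewrite reflect_offZ -v1E.
- move=> r /andP[r0 rs]; rewrite scaled.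
  have rs' : 0 <= r <= s by rewrite rs ltW.
  apply: (apart_star e0) => [j|j k /sp1[? ?]]; last exact: spoke_sep_line_gt0 rs'.
  case: (eqVneq j i) => [->|/cl1[? ?]]; last exact: clearance_line_gt0 (ltW e0) _ _ rs'.
  rewrite clearance_line hit add0r ltr_pwDl //; last by rewrite mulr_ge0 ?sqr_ge0.
  by rewrite bounce mulr_gt0 // oppr_gt0.
- by rewrite scaled.
Qed.

(** The time of the hit is the explicit root of a quadratic whose leading
    coefficient tends to 0; its limit is the time at which the hyperplane is
    hit. *)
Lemma cvg_hit_time Y V y v i (t : R) : tends Y y -> tends V v ->
  0 < t -> 0 < along y i -> along y i + t * along v i = 0 ->
  let a e := e / 2 * edot (gap ord0 (spoke i) (V e)) (gap ord0 (spoke i) (V e)) in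
  let b e := drift e (Y e) (V e) i in
  let c e := clearance e (Y e) i in
  let D e := b e ^+ 2 - 4 * a e * c e in
  D e @[e --> (0 : R)^'+] --> along v i ^+ 2 /\
  2 * c e / (Num.sqrt (D e) - b e) @[e --> (0 : R)^'+] --> t.
Proof.
move=> Yy Vv t0 y0 yt a b c D.
have v0 : along v i < 0 by nra.
have al : a e @[e --> (0 : R)^'+] --> (0 : R).
  rewrite -[X in _ --> X](mul0r (edot (gap ord0 (spoke i) v) (gap ord0 (spoke i) v))).
  apply: cvgM; last by apply: cvg_edot; exact: tends_gap.
  by rewrite -[X in _ --> X](mul0r 2^-1); apply: cvgMl; exact: cvg_right0.
have bl : b e @[e --> (0 : R)^'+] --> along v i by exact: cvg_drift Yy Vv.
have cl : c e @[e --> (0 : R)^'+] --> along y i by exact: cvg_clearance.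
have Dl : D e @[e --> (0 : R)^'+] --> along v i ^+ 2.
  have : D e @[e --> (0 : R)^'+] --> along v i * along v i - 4 * 0 * along y i.
    by apply: cvgB; [exact: cvgM | apply: cvgM => //; exact: cvgMr].
  by rewrite mulr0 mul0r subr0 -expr2.
split=> //.
have -> : t = 2 * along y i / (Num.sqrt (along v i ^+ 2) - along v i).
  rewrite sqrtr_sqr ltr0_norm //; apply/esym; apply: (canLR (mulfK _)).
    by rewrite gt_eqF //; lra.
  by lra.
apply: cvgM; first exact: cvgMr.
apply: cvgV; first by rewrite gt_eqF // sqrtr_sqr ltr0_norm //; lra.
apply: cvgB => //.
by apply: continuous_cvg Dl; exact: sqrt_continuous.
Qed.

(** Every condition in a flat run other than the closing of a contact is a
    strict inequality, and the closing happens with nonzero speed, so it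
    persists for small [e]. Initial data that depend on [e] are needed for the
    induction, as the state after the first hit does. *)
Lemma flat_run_perturb N f p f' p' : flat_run (U *m U^T) N f p f' p' ->
  forall Y V y v, tends Y y -> tends V v ->
    (forall j, f j = along y j) -> (forall j, p j = along v j) ->
  \forall e \near (0 : R)^'+, run N (star + e *: Y e) (e *: V e).
Proof.
elim=> [{}f {}p f_gt0|{}N i {}f {}p f1 p1 f2 p2 t s st _ IH] Y V y v Yy Vv fy pv.
  have /near_apart H : forall j, 0 < along y j by move=> j; rewrite -fy.
  near=> e; apply: run_free; near: e; exact: H.
have [t0 s0 f_gt0 f1_gt0 hit miss rates gaps] := st.
have y_gt0 j : 0 < along y j by rewrite -fy.
have hit_y : along y i + t * along v i = 0 by rewrite -fy -pv.
have v_lt0 : along v i < 0 by have := y_gt0 i; nra.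
have [] := cvg_hit_time Yy Vv t0 (y_gt0 i) hit_y.
set D := fun e : R => _ - _.
set T := fun e : R => _ / _.
move=> Dl Tl.
pose Y1 e := Y e + T e *: V e; pose y1 := y + t *: v.
pose V1 e := reflect_off ord0 (spoke i) (star + e *: Y1 e) (V e).
pose v1 := reflect_off ord0 (spoke i) star v.
have Y1l : tends Y1 y1 by apply: tendsD => //; exact: tendsZ.
have V1l : tends V1 v1.
  by apply: tends_reflect_off => //; exact: tends_star Y1l.
have Y2l : tends (fun e => Y1 e + s *: V1 e) (y1 + s *: v1).
  by apply: tendsD => //; apply: (@tendsZ _ _ _ (fun=> s)) => //; exact: cvg_cst.
have alongD (a b : 'M[R]_(m.+1, m)) r j :
    along (a + r *: b) j = along a j + r * along b j.
  by rewrite /along gapD gapZ !edotE.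
have p1v1 j : p1 j = along v1 j by rewrite along_reflect rates !pv.
have f1y2 j : f1 j = along (y1 + s *: v1) j.
  by rewrite alongD alongD gaps fy pv p1v1.
have next := IH _ _ _ _ Y2l V1l f1y2 p1v1.
have n1 : \forall e \near (0 : R)^'+, forall j, predC1 i j -> 0 < clearance e (Y e) j /\
     0 < clearance e (Y e) j + T e * drift e (Y e) (V e) j.
  apply: near_clearance Yy Vv Tl _ => j ji.
  by rewrite y_gt0 -fy -pv miss.
have n2 := near_spoke_sep Yy Vv Tl.
have sl : s @[_ --> (0 : R)^'+] --> s by exact: cvg_cst.
have n3 : \forall e \near (0 : R)^'+, forall j, predC1 i j -> 0 < clearance e (Y1 e) j /\
     0 < clearance e (Y1 e) j + s * drift e (Y1 e) (V1 e) j.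
  apply: near_clearance Y1l V1l sl _ => j ji.
  by rewrite -alongD -f1y2 alongD -fy -pv miss.
have n4 := near_spoke_sep Y1l V1l sl.
have n5 := near_cvg_gt0 (cvg_clearance (j := i) Yy) (y_gt0 i).
have n6 : \forall e \near (0 : R)^'+, drift e (Y e) (V e) i < 0.
  by have /cvgr_lt := cvg_drift (j := i) Yy Vv; apply.
have n7 : \forall e \near (0 : R)^'+, 0 < D e.
  by apply: near_cvg_gt0 Dl _; rewrite exprn_even_gt0 //= lt_eqF.
near=> e.
have e0 : 0 < e by [].
have c0 : 0 < clearance e (Y e) i by near: e.
have b0 : drift e (Y e) (V e) i < 0 by near: e.
have D0 : 0 < D e by near: e.
have [T0 root slope] := quadratic_root c0 b0 D0.
apply: (@run_hit_star e i (Y e) (V e) (Y1 e) (V1 e) (T e) s N) => //.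
- by rewrite clearance_line.
- by rewrite drift_line.
- by near: e.
- by near: e.
- by near: e.
- by near: e.
- by near: e.
Unshelve. all: by end_near. Qed.

End Star.

(** As the directions [u_j] form a basis, any widths and velocities of the
    contacts are obtained by moving the hub alone. *)
Lemma star_MaxCol (R : realType) (m N : nat) (U : 'M[R]_m) f p f' p' :
  U \in unitmx -> (forall i, (U *m U^T) i i = 1) ->
  (forall i j, i != j -> `|(U *m U^T) i j| < 2^-1) ->
  flat_run (U *m U^T) N f p f' p' -> MaxCol_ge R m.+1 m N.
Proof.
move=> Uu U1 U2 frun.
pose hub (x : 'I_m -> R) : 'M[R]_(m.+1, m) :=
  \matrix_(k < m.+1) if k == ord0 then (\row_j x j) *m (invmx U)^T else 0.
have along_hub x j : x j = along U (hub x) j.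
  rewrite /along /gap !rowK eqxx (eq_sym _ ord0) (negPf (neq_lift _ _)) subr0.
  rewrite edotC -(row_id 0 (_ *m _)) edot_row -mulmxA -trmx_mul mulmxV //.
  by rewrite trmx1 mulmx1 mxE.
have H := flat_run_perturb U1 U2 frun (tends_cst (y := hub f)) (tends_cst (y := hub p))
  (along_hub f) (along_hub p).
have [e] : exists e, run N (star U + e *: hub f) (e *: hub p).
  by apply: filter_ex H.
exact: run_MaxCol.
Qed.

Theorem theorem2p4 (R : realType) (n : nat) (hn : (2 <= n)%N) :
  MaxCol_ge R n (n - 1) (2 ^ (n - 1) - 1).
Proof.
case: n hn => // m _; rewrite subn1 /=.
have [U [Uu U1 U2 [f [p [f' [p' frun]]]]]] := ruler_flat_run R m.
exact: star_MaxCol Uu U1 U2 frun.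
Qed.
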